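(* Let $v, d$ be positive integers and let $W \in \mathbb{R}^{v\times d}$ be a matrix of full rank $d$ (the softmax matrix of an LLM). Then there is a linear subspace $S \subseteq \mathbb{R}^v$ with $\dim S = d$ such that for every embedding $h \in \mathbb{R}^d$ the logit vector $\ell = W h$ belongs to $S$.
   Context: A language model (LLM) with vocabulary size $v$ and embedding size $d$ produces, on any input, an embedding $h \in \mathbb{R}^d$; its logits are $\ell = W h \in \mathbb{R}^v$, where $W \in \mathbb{R}^{v\times d}$ is a fixed matrix called the softmax matrix. *)

(* Defs.v *)
From mathcomp Require Import all_boot all_algebra.
From mathcomp Require Import reals.

Set Implicit Arguments.
Unset Strict Implicit.
Unset Printing Implicit Defensive.

Import GRing.Theory.
Local Open Scope ring_scope.

(* The real numbers are an arbitrary [realType]. *)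

Definition logits (R : realType) (v d : nat) (W : 'M[R]_(v, d))
  (h : 'cV[R]_d) : 'cV[R]_v := W *m h.

(* Main.v *)
Require Import Defs.
From mathcomp Require Import all_boot all_algebra.
From mathcomp Require Import reals.

Set Implicit Arguments.
Unset Strict Implicit.
Unset Printing Implicit Defensive.

Import GRing.Theory.
Local Open Scope ring_scope.

(** Take [S] to be the column space of [W], that is, the image of [h |-> W *m h]. Rank [d] gives [W]
    a left inverse, so this map is injective and its image keeps the dimension [d] of the source. *)

Theorem theorem1 (R : realType) (v d : nat) (v_gt0 : (0 < v)%N) (d_gt0 : (0 < d)%N)
    (W : 'M[R]_(v, d)) (W_rank : \rank W = d) :
  exists S : {vspace 'cV[R]_v},
    \dim S = d /\ forall h : 'cV[R]_d, logits W h \in S.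
Proof.
pose f : 'Hom('cV[R]_d, 'cV[R]_v) := linfun (mulmx W).
have f_inj : lker f == 0%VS.
  (* [row_full] compares the rank with the number of columns, so [B] is a left inverse:
     [B *m W = 1]. *)
  have /row_fullP[B BW1] : row_full W by rewrite /row_full W_rank.
  by apply/lker0P => x y; rewrite !lfunE => /(congr1 (mulmx B)); rewrite !mulmxA BW1 !mul1mx.
exists (limg f); split=> [|h].
  (* Column vectors are [d]-by-1 matrices, so their space has dimension [d * 1]. *)
  rewrite limg_dim_eq; first by rewrite dimvf /dim /= muln1.
  by rewrite (eqP f_inj) capv0.
by rewrite /logits -[W *m h](lfunE (mulmx W)) memv_img ?memvf.
Qed.
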